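(* Let $(\Omega,\mathcal{F})$ and $(\mathsf{Y},\mathcal{F}_Y)$ be standard Borel spaces, let $\mu$ be a probability measure on $\Omega$, let $K$ be a similarity kernel on $\Omega$, and let $P(\cdot\mid\cdot)$ be a Markov kernel from $\Omega$ to $\mathsf{Y}$. Let $\mu_{XY}$ be the joint law of $(X,Y)$ given by $\mu_{XY}(A\times B)=\int_A P(B\mid\omega)\,d\mu(\omega)$ for $A\in\mathcal{F}$, $B\in\mathcal{F}_Y$, and let $\mu_Y(B)=\int_\Omega P(B\mid\omega)\,d\mu(\omega)$ be its marginal on $\mathsf{Y}$. Let $K^{\mathsf{Y},\mu}$ be the posterior-induced output kernel on $\mathsf{Y}$ of the joint law $\mu_{XY}$. Then $$H_{K^{\mathsf{Y},\mu}}(\mu_Y)\ \le\ H_K(\mu).$$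
   Context: A similarity kernel on a measurable space $(\Omega,\mathcal{F})$ is a map $K:\Omega\times\Omega\to[0,1]$ that is $\mathcal{F}\otimes\mathcal{F}$-measurable, symmetric, and satisfies $K(\omega,\omega)=1$ for all $\omega$. For a probability measure $\mu$ on $\Omega$, the typicality function is $\tau(\omega):=\int_\Omega K(\omega,\omega')\,d\mu(\omega')$ and the $K$-entropy is $H_K(\mu):=\int_\Omega(-\log\tau(\omega))\,d\mu(\omega)\in[0,\infty]$, with $-\log 0:=+\infty$. A Markov kernel from $\Omega$ to $\mathsf{Y}$ is a map $(\omega,B)\mapsto P(B\mid\omega)$ such that $P(\cdot\mid\omega)$ is a probability measure on $(\mathsf{Y},\mathcal{F}_Y)$ for each $\omega$ and $\omega\mapsto P(B\mid\omega)$ is $\mathcal{F}$-measurable for each $B\in\mathcal{F}_Y$. Posterior-induced output kernel of a joint law $\mu_{XY}$: let $\{\mu_{X\mid Y=y}\}_{y\in\mathsf{Y}}$ be a regular conditional law of $X$ given $Y$. Then $K^{\mathsf{Y},\mu}:\mathsf{Y}\times\mathsf{Y}\to[0,1]$ is defined, up to $(\mu_Y\otimes\mu_Y)$-a.e. equality (a measurable version is taken), by $K^{\mathsf{Y},\mu}(y,y')=1$ if $y=y'$, and, if $y\ne y'$, $K^{\mathsf{Y},\mu}(y,y')$ is the essential supremum of $(\omega,\omega')\mapsto K(\omega,\omega')$ with respect to $\mu_{X\mid Y=y}\otimes\mu_{X\mid Y=y'}$. *)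

(* Defs.v *)
From HB Require Import structures.
From mathcomp Require Import all_boot all_order all_algebra.
From mathcomp Require Import all_classical all_reals all_analysis.
From mathcomp Require Import measurable_realfun ess_sup_inf.

Set Implicit Arguments.
Unset Strict Implicit.
Unset Printing Implicit Defensive.

Import Order.TTheory GRing.Theory Num.Theory.
Import numFieldNormedType.Exports.

Local Open Scope classical_set_scope.
Local Open Scope ring_scope.
Local Open Scope ereal_scope.

(* [T] is Borel isomorphic to a separable complete metric space. The field [R]
   only serves as the codomain of the distance. *)
Definition standard_borel (R : realType) d (T : measurableType d) : Prop :=
  exists M : metricType R,
    [/\ forall F : set_system M, ProperFilter F -> cauchy F ->
          exists l : M, F --> l,
        exists2 D : set M, countable D & dense D
      & exists2 f : T -> M, bijective f &
          @measurable d T = [set f @^-1` U | U in <<s @open M >>]].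

(* A value [k x] of a probability kernel is, for the library, only a measure;
   this copy carries the probability structure. *)
Section pker_val.
Context d d' (X : measurableType d) (Y : measurableType d') (R : realType).
Variables (k : R.-pker X ~> Y) (x : X).

Definition pker_val : set Y -> \bar R := k x.

HB.instance Definition _ := Measure.on pker_val.

HB.instance Definition _ :=
  Measure_isProbability.Build _ _ _ pker_val (prob_kernel x).

End pker_val.

Section similarity.
Context d (T : measurableType d) (R : realType).

Definition similarity_kernel (K : T -> T -> R) : Prop :=
  [/\ measurable_fun [set: T * T] (fun p => K p.1 p.2),
      forall w w', (0 <= K w w' <= 1)%R,
      forall w w', K w w' = K w' w
    & forall w, K w w = 1%R].

Definition typicality (mu : probability T R) (K : T -> T -> R) (w : T) : \bar R :=
  \int[mu]_w' (K w w')%:E.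

Definition K_entropy (mu : probability T R) (K : T -> T -> R) : \bar R :=
  \int[mu]_w (- lne (typicality mu K w)).

End similarity.

Section joint_law.
Context d d' (X : measurableType d) (Y : measurableType d') (R : realType).
Variables (mu : probability X R) (P : R.-pker X ~> Y).

(* [joint_lawX] below gives the value on rectangles, which characterizes it. *)
Definition joint_law (C : set (X * Y)) : \bar R :=
  \int[mu]_w P w (xsection C w).

Let joint_law0 : joint_law set0 = 0.
Proof. by rewrite /joint_law integral0_eq// => w _; rewrite xsection0. Qed.

Let joint_law_ge0 C : 0 <= joint_law C.
Proof. by apply: integral_ge0 => w _. Qed.

Let measurable_section C : measurable C ->
  measurable_fun [set: X] (fun w => P w (xsection C w)).
Proof.
by move=> mC; apply: measurable_fun_xsection_finite_kernel => //; rewrite inE.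
Qed.

Let joint_law_sigma_additive : semi_sigma_additive joint_law.
Proof.
move=> F mF tF mUF.
rewrite [X in _ --> X](_ : _ = \sum_(n <oo) joint_law (F n)).
  by apply/cvg_closeP; split; [exact: is_cvg_nneseries|rewrite closeE].
rewrite -integral_nneseries//; last by move=> n; exact: measurable_section.
apply: eq_integral => x _; apply/esym/cvg_lim => //=; rewrite xsection_bigcup.
apply: (measure_sigma_additive _ (trivIset_xsection tF)) => ?.
exact: measurable_xsection.
Qed.

HB.instance Definition _ := isMeasure.Build _ _ _ joint_law
  joint_law0 joint_law_ge0 joint_law_sigma_additive.

Let joint_law_setT : joint_law setT = 1.
Proof.
rewrite /joint_law -[RHS](@probability_setT _ _ _ mu) -[RHS]mul1e.
rewrite -integral_cst//; apply: eq_integral => w _ /=.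
by rewrite -setXTT in_xsectionX ?inE// prob_kernel.
Qed.

HB.instance Definition _ :=
  Measure_isProbability.Build _ _ _ joint_law joint_law_setT.

Lemma joint_lawX A B : measurable A -> measurable B ->
  joint_law (A `*` B) = \int[mu]_(w in A) P w B.
Proof.
move=> mA mB; rewrite /joint_law [RHS]integral_mkcond.
apply: eq_integral => w _; rewrite patchE; case: ifPn => wA.
  by rewrite in_xsectionX.
by rewrite notin_xsectionX// measure0.
Qed.

Definition output_law (B : set Y) : \bar R := \int[mu]_w P w B.

Lemma output_lawE : output_law = pushforward joint_law snd.
Proof.
apply/funext => B; rewrite /pushforward /output_law /joint_law -setTX.
by apply: eq_integral => w _; rewrite in_xsectionX ?inE.
Qed.

Let output_law0 : output_law set0 = 0.
Proof. by rewrite output_lawE /pushforward preimage_set0 measure0. Qed.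

Let output_law_ge0 B : 0 <= output_law B.
Proof. by apply: integral_ge0 => w _. Qed.

Let output_law_sigma_additive : semi_sigma_additive output_law.
Proof. by rewrite output_lawE; exact: measure_semi_sigma_additive. Qed.

HB.instance Definition _ := isMeasure.Build _ _ _ output_law
  output_law0 output_law_ge0 output_law_sigma_additive.

Let output_law_setT : output_law setT = 1.
Proof. by rewrite output_lawE /pushforward preimage_setT probability_setT. Qed.

HB.instance Definition _ :=
  Measure_isProbability.Build _ _ _ output_law output_law_setT.

End joint_law.

Section posterior.
Context d d' (X : measurableType d) (Y : measurableType d') (R : realType).
Variable muXY : probability (X * Y)%type R.

Definition regular_conditional_law (kappa : R.-pker Y ~> X) : Prop :=
  forall A B, measurable A -> measurable B ->
    muXY (A `*` B) = \int[pushforward muXY snd]_(y in B) kappa y A.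

Definition posterior_similarity (K : X -> X -> R) (kappa : R.-pker Y ~> X)
    (y y' : Y) : \bar R :=
  if y == y' then 1
  else ess_sup (pker_val kappa y \x pker_val kappa y')
         (fun p : X * X => (K p.1 p.2)%:E).

(* [KY] is any measurable version: the kernel is only defined almost everywhere
   for the product of the marginals. If the marginal is diffuse, the diagonal is
   null and [KY y y] is unconstrained; at atoms [KY y y = 1] is forced. *)
Definition posterior_induced_kernel (K : X -> X -> R) (KY : Y -> Y -> R) : Prop :=
  [/\ measurable_fun [set: Y * Y] (fun p => KY p.1 p.2),
      forall y y', (0 <= KY y y' <= 1)%R
    & exists2 kappa : R.-pker Y ~> X, regular_conditional_law kappa &
        {ae pushforward muXY snd \x pushforward muXY snd, forall p : Y * Y,
          (KY p.1 p.2)%:E = posterior_similarity K kappa p.1 p.2}].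

End posterior.

(* Main.v *)
Require Import Defs.
From mathcomp Require Import all_boot all_order all_algebra.
From mathcomp Require Import all_classical all_reals all_analysis.
From mathcomp Require Import measurable_realfun ess_sup_inf.

Set Implicit Arguments.
Unset Strict Implicit.
Unset Printing Implicit Defensive.

Import Order.TTheory GRing.Theory Num.Theory.
Local Open Scope classical_set_scope.
Local Open Scope ring_scope.
Local Open Scope ereal_scope.

(** Write [nu] for the law of Y, [kappa y] for the posterior given [y], [tau]
    for the typicality of [mu] under [K] and [tauY] for that of [nu] under [KY].
    The inequality already holds pointwise, before any averaging:

      [tau w <= tauY y] for [nu]-almost every [y] and [kappa y]-almost every [w].

    Indeed, an essential supremum bounds its function almost everywhere, so
    that for almost all [y], [y'] one has [K w w' <= KY y y'] for almost all
    [(w, w')] under the product of the posteriors at [y] and [y']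
    ([ae_le_posterior_similarity]).  Integrating over [w'] gives
    [\int[kappa y']_w' K w w' <= KY y y'] for almost every [w]; by Tonelli the
    two almost-everywhere quantifiers on [y'] and [w] may be exchanged
    ([ae_swap]); integrating over [y'] then turns the right side into [tauY y],
    and the left side into [tau w], since [mu] is the [nu]-mixture of the
    posteriors ([integral_mixture]).  This is [ae_typicality_le].

    Since [- lne] is decreasing, [- lne (tauY y)] is at most the [kappa y]-mean
    of [- lne (tau w)].  Integrating over [y] and using the mixture formula once
    more gives the comparison of entropies ([K_entropy_posterior_le]). *)

Lemma ge0_lee_lne (R : realType) :
  {in [pred x : \bar R | 0 <= x] &, {homo @lne R : x y / x <= y}}.
Proof.
by move=> x y x0 y0 xy; rewrite lee_lne// in_itv/= leey andbT.
Qed.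

(** The open ray above [r] pulls back to the open ray above [expR r]; the values
    at nonpositive arguments, all [-oo], stay below every [r]. *)
Lemma measurable_lne (R : realType) : measurable_fun [set: \bar R] (@lne R).
Proof.
move=> _; apply: (measurability _ (ErealGenOInfty.measurableE R)) => //.
move=> _ [_ [r ->] <-]; rewrite setTI.
rewrite (_ : _ @^-1` _ = `](expeR r%:E), +oo[%classic); first exact: emeasurable_itv.
apply/seteqP; split => x /=; rewrite !in_itv/= !andbT.
  have [x0|x0] := leP x 0; first by rewrite le0_lneNy.
  by rewrite -lte_expeR lneK// in_itv/= leey ltW.
move=> rx; rewrite -lte_expeR lneK// in_itv/= leey andbT.
by rewrite (le_trans _ (ltW rx))// expeR_ge0.
Qed.

Lemma ae_integral_eq0 d (T : measurableType d) (R : realType)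
    (m : {measure set T -> \bar R}) (f : T -> \bar R) :
  measurable_fun setT f -> (forall x, 0 <= f x) ->
  \int[m]_x f x = 0 <-> \forall x \ae m, f x = 0.
Proof.
move=> mf f0; have := ae_eq_integral_abs m measurableT mf.
rewrite (eq_integral f) => [[h1 h2]|x _]; last by rewrite gee0_abs.
split=> [/h1|h].
  by apply: filterS => x /(_ I).
by apply: h2; apply: filterS h => x.
Qed.

Section ae_product.
Context d1 d2 (T1 : measurableType d1) (T2 : measurableType d2) (R : realType).
Variables (m1 : {sigma_finite_measure set T1 -> \bar R})
          (m2 : {sigma_finite_measure set T2 -> \bar R}).

Lemma ae_xsection (Q : T1 * T2 -> Prop) :
  (\forall p \ae (m1 \x m2), Q p) -> \forall x \ae m1, \forall y \ae m2, Q (x, y).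
Proof.
move=> [N [mN N0 QN]].
have /ae_integral_eq0 : \int[m1]_x (m2 \o xsection N) x = 0 by exact: N0.
have h : forall x, 0 <= (m2 \o xsection N) x by move=> x /=.
move=> /(_ (measurable_fun_xsection m2 mN) h); apply: filterS => x /= Nx0.
exists (xsection N x); split => //; first exact: measurable_xsection.
by move=> y /= nQ; rewrite /xsection/= inE; apply: QN.
Qed.

(** The measurability of [Q] lets Tonelli compute the mass of its complement
    along either family of sections. *)
Lemma ae_swap (Q : T1 * T2 -> Prop) : measurable [set p | Q p] ->
  (\forall y \ae m2, \forall x \ae m1, Q (x, y)) ->
  \forall x \ae m1, \forall y \ae m2, Q (x, y).
Proof.
move=> mQ Q21; apply: ae_xsection; exists (~` [set p | Q p]).
have mC : measurable (~` [set p | Q p]) by exact: measurableC.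
split => //.
transitivity (\int[m2]_y (m1 \o ysection (~` [set p | Q p])) y).
  rewrite -[LHS]/(\int[m1]_x _ x) -indic_fubini_tonelli_FE//.
  by rewrite -indic_fubini_tonelli_GE// indic_fubini_tonelli.
apply/ae_integral_eq0 => //; first exact: measurable_fun_ysection.
apply: filterS Q21 => y [N [mN N0 QN]] /=.
apply/eqP; rewrite -measure_le0 -N0 le_measure ?inE//.
  exact: measurable_ysection.
by move=> x; rewrite /ysection/= inE => /=; apply: QN.
Qed.

End ae_product.

(** The mixture is the composition of the constant kernel at [nu] with [kappa], so
    the iterated-integral formula for composed kernels applies. *)
Lemma integral_mixture d d' (X : measurableType d) (Y : measurableType d')
    (R : realType) (mu : {measure set X -> \bar R}) (nu : probability Y R)
    (kappa : R.-pker Y ~> X) (f : X -> \bar R) :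
  (forall A, measurable A -> mu A = \int[nu]_y kappa y A) ->
  (forall x, 0 <= f x) -> measurable_fun setT f ->
  \int[mu]_x f x = \int[nu]_y \int[kappa y]_x f x.
Proof.
move=> muE f0 mf.
pose cstnu : R.-sfker unit ~> Y :=
  kprobability (measurable_cst (nu : pprobability Y R) : measurable_fun [set: unit] _).
pose snd_kappa : R.-sfker (unit * Y) ~> X := kernel.kernel_snd kappa.
rewrite -[RHS](integral_kcomp cstnu snd_kappa tt f0 mf).
by apply: eq_measure_integral => A mA _; rewrite muE.
Qed.

(** The [surprise] of a point is the integrand [- lne tau] of the entropy. *)
Section typicality.
Context d (T : measurableType d) (R : realType) (mu : probability T R).
Variable K : T -> T -> R.
Hypothesis mK : measurable_fun [set: T * T] (fun p => K p.1 p.2).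
Hypothesis K01 : forall w w', (0 <= K w w' <= 1)%R.

Let mKE : measurable_fun [set: T * T] (fun p => (K p.1 p.2)%:E).
Proof. exact/measurable_EFinP. Qed.

Lemma measurable_typicality : measurable_fun setT (typicality mu K).
Proof.
rewrite -[typicality mu K]/(fubini_F mu (fun p => (K p.1 p.2)%:E)).
apply: measurable_fun_fubini_tonelli_F => // p.
by rewrite lee_fin; have /andP[] := K01 p.1 p.2.
Qed.

Lemma typicality_ge0 w : 0 <= typicality mu K w.
Proof.
by apply: integral_ge0 => w' _; rewrite lee_fin; have /andP[] := K01 w w'.
Qed.

Lemma typicality_le1 w : typicality mu K w <= 1.
Proof.
rewrite -(@probability_setT _ _ _ mu) -[leRHS]mul1e -integral_cst//.
apply: ge0_le_integral => //.
- by move=> w' _; rewrite lee_fin; have /andP[] := K01 w w'.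
- exact: measurable_fun_pair2 mKE.
- by move=> w' _; rewrite lee_fin; have /andP[] := K01 w w'.
Qed.

Lemma surprise_ge0 w : 0 <= - lne (typicality mu K w).
Proof. by rewrite oppe_ge0 lne_le0 typicality_le1. Qed.

Lemma measurable_surprise :
  measurable_fun setT (fun w => - lne (typicality mu K w)).
Proof.
by apply/measurableT_comp => //; apply: (measurableT_comp (@measurable_lne R));
  exact: measurable_typicality.
Qed.

End typicality.

Section posterior_typicality.
Context d d' (X : measurableType d) (Y : measurableType d') (R : realType).
Variables (mu : probability X R) (nu : probability Y R) (kappa : R.-pker Y ~> X).
Variables (K : X -> X -> R) (KY : Y -> Y -> R).
Hypothesis mK : measurable_fun [set: X * X] (fun p => K p.1 p.2).
Hypothesis K01 : forall w w', (0 <= K w w' <= 1)%R.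
Hypothesis mKY : measurable_fun [set: Y * Y] (fun p => KY p.1 p.2).
Hypothesis KY01 : forall y y', (0 <= KY y y' <= 1)%R.
Hypothesis muE : forall A, measurable A -> mu A = \int[nu]_y kappa y A.
Hypothesis KYE : \forall p \ae (nu \x nu),
  (KY p.1 p.2)%:E = posterior_similarity K kappa p.1 p.2.

Let mKE : measurable_fun [set: X * X] (fun p => (K p.1 p.2)%:E).
Proof. exact/measurable_EFinP. Qed.

Let K0 w w' : 0 <= (K w w')%:E.
Proof. by rewrite lee_fin; have /andP[] := K01 w w'. Qed.

Lemma ae_le_posterior_similarity y y' :
  \forall p \ae (pker_val kappa y \x pker_val kappa y'),
    (K p.1 p.2)%:E <= posterior_similarity K kappa y y'.
Proof.
rewrite /posterior_similarity; case: ifPn => _; last exact: ess_sup_ge.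
by apply: nearW => p; rewrite lee_fin; have /andP[] := K01 p.1 p.2.
Qed.

Let mean_sim (p : X * Y) : \bar R := \int[kappa p.2]_w' (K p.1 w')%:E.

Let measurable_mean_sim : measurable_fun setT mean_sim.
Proof.
pose snd_kappa : R.-fker (X * Y) ~> X := kernel.kernel_snd kappa.
apply: (@measurable_fun_integral_finite_kernel _ _ _ _ _
  (fun q : (X * Y) * X => (K q.1.1 q.2)%:E) snd_kappa) => //.
apply: (measurableT_comp mKE (g := fun q : (X * Y) * X => (q.1.1, q.2))).
by apply/measurable_fun_pair => //; exact: measurableT_comp.
Qed.

Lemma ae_typicality_le : \forall y \ae nu, \forall w \ae pker_val kappa y,
  typicality mu K w <= typicality nu KY y.
Proof.
apply: filterS (ae_xsection KYE) => y KYy /=.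
have mKYy : measurable_fun setT (fun y' => (KY y y')%:E).
  by apply/measurable_EFinP; exact: measurable_fun_pair2 mKY.
have sim_le : \forall w \ae pker_val kappa y, \forall y' \ae nu,
    mean_sim (w, y') <= (KY y y')%:E.
  apply: (@ae_swap _ _ _ _ _ (pker_val kappa y) nu
    (fun p => mean_sim p <= (KY y p.2)%:E)).
    rewrite -[X in measurable X]setTI.
    apply: emeasurable_fun_le => //.
    exact: measurableT_comp mKYy _.
  apply: filterS KYy => y' /= KYy'.
  apply: filterS (ae_xsection (ae_le_posterior_similarity y y')) => w /= Kw.
  (* The constant [KY y y'] is its own mean under the posterior at [y']. *)
  rewrite KYy' -[leRHS]mule1 -(@probability_setT _ _ _ (pker_val kappa y')).
  rewrite -integral_cst//; apply: ae_ge0_le_integral => //.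
  - exact: measurable_fun_pair2 mKE.
  - by move=> w' _; rewrite -KYy' lee_fin; have /andP[] := KY01 y y'.
  - by apply: filterS Kw.
apply: filterS sim_le => w /= sim_le.
rewrite /typicality (integral_mixture muE)//; last exact: measurable_fun_pair2 mKE.
apply: ae_ge0_le_integral => //.
- by move=> y' _; exact: integral_ge0.
- exact: measurable_fun_pair2 measurable_mean_sim.
- by move=> y' _; rewrite lee_fin; have /andP[] := KY01 y y'.
- by apply: filterS sim_le.
Qed.

(** Stated for any kernel [kappa] whose [nu]-mixture is [mu], so as to separate
    the argument from the construction of the joint law. *)
Lemma K_entropy_posterior_le : K_entropy nu KY <= K_entropy mu K.
Proof.
rewrite /K_entropy (integral_mixture muE); last 2 first.
- exact: surprise_ge0.
- exact: measurable_surprise.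
apply: ae_ge0_le_integral => //.
- by move=> y _; exact: surprise_ge0.
- exact: measurable_surprise.
- by move=> y _; apply: integral_ge0 => w _; exact: surprise_ge0.
- apply: measurable_fun_integral_kernel => //.
  + by move=> U; exact: measurable_kernel.
  + exact: surprise_ge0.
  + exact: measurable_surprise.
apply: filterS ae_typicality_le => y ty _.
(* The left side does not depend on [w]: it is its own mean under [kappa y]. *)
rewrite -[leLHS]mule1 -(@probability_setT _ _ _ (pker_val kappa y)) -integral_cst//.
apply: ae_ge0_le_integral => //.
- by move=> w _; exact: surprise_ge0.
- by move=> w _; exact: surprise_ge0.
- exact: measurable_surprise.
apply: filterS ty => w tw _; rewrite /cst leeN2.
by apply: ge0_lee_lne => //; rewrite inE typicality_ge0.
Qed.

End posterior_typicality.

Theorem theorem5p2 (R : realType) (d d' : measure_display)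
    (Omega : measurableType d) (Y : measurableType d')
    (mu : probability Omega R) (K : Omega -> Omega -> R)
    (P : R.-pker Omega ~> Y) (KY : Y -> Y -> R) :
  standard_borel R Omega -> standard_borel R Y ->
  similarity_kernel K ->
  posterior_induced_kernel (joint_law mu P) K KY ->
  K_entropy (output_law mu P) KY <= K_entropy mu K.
Proof.
move=> _ _ [mK K01 _ _] [mKY KY01 [kappa]].
rewrite /regular_conditional_law -output_lawE => kappaE KYE.
apply: (@K_entropy_posterior_le _ _ _ _ _ _ _ kappa) => // A mA.
(* The posterior mixture recovers [mu] as the first marginal of the joint law. *)
rewrite -kappaE// [RHS](joint_lawX mu P mA measurableT).
rewrite (eq_integral (cst 1)) => [|w _]; last exact: prob_kernel.
by rewrite integral_cst// mul1e.
Qed.
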